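(* Let $t(n,k)$ be the number of paths in $\mathcal{M}_1$ of length $n$ whose end-point has height $k$. Then, for $n,k\ge0$, $t(n,k)$ equals $$\sum_{i=0}^{n-k}\binom{k+\frac{n-k-i}{2}}{\frac{n-k-i}{2}}\frac{1+(-1)^{n-k-i}}{2}\sum_{j=0}^iC_{k+j,k}\sum_{m=0}^{j}\binom{j}{m} (-1)^m\sum_{p=0}^m\binom{m}{p}(-1)^p\binom{2j-1+\frac{i-j-m-p}{2}}{\frac{i-j-m-p}{2}}\frac{1+(-1)^{i-j-m-p}}{2},$$ where $C_{n,k}=\frac{k+1}{n+1}\binom{2n-k}{n-k}$.
   Context: Let $U=(1,1)$, $H=(1,0)$ and $D_k=(1,-k)$ for $k\ge 1$ (down steps). $\mathcal{M}_1$ is the set of lattice paths in $\mathbb{N}^2$ (with $\mathbb{N}=\{0,1,2,\dots\}$, so paths never go below the $x$-axis) starting at the origin, made of steps $U$, $H$ and $D_k$ ($k\ge1$), in which two down steps are never consecutive. The empty path belongs to $\mathcal{M}_1$. The length of a path is its number of steps; the height of a point is its ordinate. Conventions: for integers $a,b$, $\binom{a}{b}=a(a-1)\cdots(a-b+1)/b!$ if $b\ge0$ (so $\binom{a}{0}=1$ for every integer $a$) and $\binom{a}{b}=0$ if $b<0$; a term containing a factor $\frac{1+(-1)^a}{2}$ with $a$ odd is $0$; empty sums are $0$. *)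

(* Defs.v *)
From mathcomp Require Import all_boot all_order all_algebra.
From mathcomp Require Import finmap.
From mathcomp Require Import boolp classical_sets functions cardinality.
From mathcomp Require Import zify.

Set Implicit Arguments.
Unset Strict Implicit.
Unset Printing Implicit Defensive.

Import Order.TTheory GRing.Theory Num.Theory.

Local Open Scope classical_set_scope.
Local Open Scope ring_scope.

Definition vec : Type := (int * int)%type.

Definition up_step : vec := (1, 1).
Definition flat_step : vec := (1, 0).
Definition down_step (k : nat) : vec := (1, - k%:Z).

Definition down_steps : set vec := [set down_step k | k in [set k | (1 <= k)%N]].
Definition steps : set vec := [set up_step; flat_step] `|` down_steps.

(* A path starting at the origin is the sequence of its steps; [point p i] is
   the point reached after the first [i] steps. *)
Definition point (p : seq vec) (i : nat) : vec := \sum_(s <- take i p) s.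

Definition endpoint (p : seq vec) : vec := point p (size p).

Definition height (v : vec) : int := v.2.

Definition M1 : set (seq vec) := [set p |
  [/\ (forall s, s \in p -> steps s),
      (forall i, (i <= size p)%N -> 0 <= (point p i).1 /\ 0 <= (point p i).2)
    & (forall i, (i.+1 < size p)%N ->
         ~ (down_steps (nth 0 p i) /\ down_steps (nth 0 p i.+1)))]].

Definition M1_paths (n k : nat) : set (seq vec) :=
  [set p | [/\ M1 p, size p = n & height (endpoint p) = k%:Z]].

(* [fset_set] is only meaningful on finite sets: see [finite_M1_paths]. *)
Definition t (n k : nat) : nat := #|` fset_set (M1_paths n k)|.

Definition binz (a b : int) : rat :=
  if 0 <= b then (\prod_(0 <= l < `|b|%N) (a%:~R - l%:R)) / (`|b|%N)`!%:R else 0.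

Definition even_ind (a : int) : rat := (1 + (-1) ^ a) / 2%:R.

(* Rounded down for odd [a]; in the theorem such terms carry the factor
   [even_ind a], which is then 0. *)
Definition halfz (a : int) : int := (a %/ 2)%Z.

Definition ballot (n k : nat) : rat :=
  k.+1%:R / n.+1%:R * binz ((2 * n)%:Z - k%:Z) (n%:Z - k%:Z).

Lemma even_ind_odd (a : int) : ~~ (2 %| a)%Z -> even_ind a = 0.
Proof.
rewrite /even_ind => a_odd.
suff -> : (-1 : rat) ^ a = -1 by rewrite subrr mul0r.
have Podd m : odd m -> (-1 : rat) ^+ m = -1.
  by move=> om; rewrite -signr_odd om expr1.
case: a a_odd => m a_odd.
  by rewrite -exprnP Podd //; move: a_odd; lia.
rewrite NegzE -exprnN Podd ?invrN1 //.
by move: a_odd; lia.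
Qed.

Lemma pointS (p : seq vec) (i : nat) :
  (i < size p)%N -> point p i.+1 = point p i + nth 0 p i.
Proof.
by move=> hi; rewrite /point (take_nth 0) // -cats1 big_cat big_seq1.
Qed.

Lemma point_le (p : seq vec) (i : nat) :
  (forall s, s \in p -> steps s) -> (i <= size p)%N -> (point p i).2 <= i%:Z.
Proof.
move=> hp; elim: i => [|i IHi] hi; first by rewrite /point take0 big_nil.
have le_i := IHi (ltnW hi).
have -> : (point p i.+1).2 = (point p i).2 + (nth 0 p i).2 by rewrite pointS.
have : steps (nth 0 p i) by apply: hp; rewrite mem_nth.
by case=> [[->|->]|[k _ <-]]; rewrite /down_step /=; lia.
Qed.

Lemma finite_M1_paths (n k : nat) : finite_set (M1_paths n k).
Proof.
pose f (d : {ffun 'I_n -> 'I_n.+2}) : seq vec :=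
  mkseq (fun i => (1, 1 - (if insub i is Some j then d j : nat else 0%N)%:Z)) n.
have fin : finite_set (range f) by apply: finite_image; exact: finite_finset.
apply: sub_finite_set fin => p [[hs hq _] sp _].
exists [ffun i : 'I_n => inord `|1 - (nth 0%R p i).2|%N] => //.
apply: (@eq_from_nth _ 0); rewrite size_mkseq // => i lin.
rewrite nth_mkseq // insubT /= ffunE /=.
have lip : (i < size p)%N by rewrite sp.
have si : steps (nth 0 p i) by apply: hs; rewrite mem_nth.
have le1 := point_le hs (ltnW lip).
have [_ ge0] := hq _ lip.
have e : (point p i.+1).2 = (point p i).2 + (nth 0 p i).2.
  by rewrite pointS.
have [e1 e2] : (nth 0 p i).1 = 1 /\ (nth 0 p i).2 <= 1.
  by case: si => [[->|->]|[l _ <-]] /=; split => //; lia.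
rewrite e in ge0.
have e3 : (nth 0 p i) = (1, (nth 0 p i).2) by rewrite -e1; case: (nth 0 p i).
rewrite e3 /=; move: (nth 0 p i).2 (point p i).2 ge0 e2 le1 => x y ge0 e2 le1.
rewrite inordK; first by congr pair; lia.
lia.
Qed.

(* Main.v *)
From mathcomp Require Import all_boot all_order all_algebra.
From mathcomp Require Import finmap.
From mathcomp Require Import boolp classical_sets cardinality.
From mathcomp Require Import zify lra.
Require Import Defs.

(** The proof compares generating functions.  Split the paths that end at height
    [k] into those whose last step is not down, with generating function
    [A_k(z)], and the others; let [T_k(z)] count all of them.  Removing the last
    step gives [A_0 = 1 + z T_0], [A_(k+1) = z (T_(k+1) + T_k)] and
    [T_k = A_k + z (A_(k+1) + A_(k+2) + ...)].  Subtracting two consecutive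
    instances of the last equation leaves the finite relation
    [T_k - T_(k+1) = A_k - A_(k+1) + z A_(k+1)], which together with
    [T_k = O(z^k)] determines everything ([size_paths_series]).  In terms of [T]
    alone it reads
    [z T_(k-1) - (1 - z^2) T_k + (1 - z + z^2) T_(k+1) = 0], with [z T_(-1) = 1].

    The solutions of this linear recurrence in [k] are powers of a root [v] of
    [z - (1 - z^2) v + (1 - z + z^2) v^2 = 0], namely
    [v = z / (1 - z^2) C(x)] with [x = z (1 - z + z^2) / (1 - z^2)^2] and [C] the
    Catalan series.  Hence [T_k = z^k / (1 - z^2)^(k+1) C(x)^(k+1)].  Since the
    coefficients of [C^(k+1)] are the ballot numbers, expanding
    [1 - z + z^2 = 1 - z (1 - z)] twice by the binomial theorem and
    [1 / (1 - z^2)] by the negative binomial series gives the announced formula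
    ([coef_total_series]).

    That these [T_k] satisfy the linear recurrence is checked directly, from the
    recurrence of the ballot numbers: coefficientwise it says
    [C^(k+1) = C^k + x C^(k+2)] ([kernel_equation]).  Power series are replaced by
    polynomials that are correct below a degree [N] chosen larger than the length
    of the paths. *)

Set Implicit Arguments.
Unset Strict Implicit.
Unset Printing Implicit Defensive.

Import Order.TTheory GRing.Theory Num.Theory.
Local Open Scope ring_scope.

(** * Binomial coefficients and parity indicators *)

Lemma binz_nat (a b : nat) : binz a%:Z b%:Z = 'C(a, b)%:R.
Proof.
rewrite /binz /= big_mkord.
have [le_ba|lt_ab] := leqP b a; last first.
  rewrite bin_small // (bigD1 (Ordinal lt_ab)) //=.
  by rewrite -pmulrn subrr !mul0r.
have -> : \prod_(l < b) ((a%:Z)%:~R - l%:R) = (a ^_ b)%:R :> rat.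
  rewrite ffact_prod natr_prod; apply: eq_bigr => l _.
  by rewrite -pmulrn natrB // (leq_trans (ltnW (ltn_ord l))).
by rewrite -bin_ffact natrM mulfK // pnatr_eq0 -lt0n fact_gt0.
Qed.

Lemma binz0 (a : int) : binz a 0 = 1.
Proof. by rewrite /binz /= big_nil fact0 divr1. Qed.

Lemma binz_halfz_neg (a d : int) : d < 0 -> binz a (halfz d) = 0.
Proof. by rewrite /binz /halfz => d_lt0; rewrite ifF //; lia. Qed.

Lemma even_ind_even (l : nat) : even_ind l.*2%:Z = 1.
Proof. by rewrite /even_ind -exprnP -muln2 mulnC exprM sqrrN !expr1n. Qed.

(** * The closed form as a coefficient *)

Section Series.

Variable N : nat.

(** [1 / (1 - z^2)], correct below degree [2 * N]. *)
Definition geom2 : {poly rat} := \sum_(l < N) 'X^2 ^+ l.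

Lemma geom2_inv : (1 - 'X^2) * geom2 = 1 - 'X^(2 * N).
Proof.
have := subrX1 ('X^2 : {poly rat}) N; rewrite -exprM -/geom2 => e.
by rewrite -opprB mulNr -e opprB.
Qed.

(** Multiplying by [1 - z^2] lowers the exponent [a], so that Pascal's rule drives
    the induction.  The predecessor makes the formula right for [a = 0] as well:
    ['C(h.-1, h)] is 1 when [h = 0] and 0 otherwise. *)
Lemma coef_geom2X (a l : nat) : (l < 2 * N)%N ->
  (geom2 ^+ a)`_l = if odd l then 0 else 'C((a + l./2).-1, l./2)%:R.
Proof.
elim: a l => [|a IHa] l.
  case: l => [|[|l]] _; rewrite coef1 //=.
  by rewrite negbK bin_small //; case: odd.
have rec : geom2 ^+ a.+1 =
    geom2 ^+ a + 'X^2 * geom2 ^+ a.+1 - 'X^(2 * N) * geom2 ^+ a.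
  have := congr1 (fun p => p * geom2 ^+ a) geom2_inv.
  rewrite -mulrA -exprS !mulrBl !mul1r => /eqP; rewrite subr_eq addrAC.
  exact: eqP.
have [m] := ubnP l; elim: m l => // m IHm l lt_lm lt_lN.
rewrite rec coefB coefD !coefXnM lt_lN subr0 IHa //.
case: l lt_lm lt_lN => [|[|l]] lt_lm lt_lN; rewrite ?addr0 //=.
  by rewrite !bin0.
rewrite subn2 /= IHm ?negbK; [|lia|lia].
case: odd; first by rewrite addr0.
rewrite -natrD; congr _%:R.
by rewrite !addSn !addnS /= binS.
Qed.

Lemma coef_geom2X_binz (a l : nat) : (l < 2 * N)%N ->
  (geom2 ^+ a)`_l =
  binz (a%:Z - 1 + halfz l%:Z) (halfz l%:Z) * even_ind l%:Z.
Proof.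
move=> lt_lN; rewrite coef_geom2X //; case: ifPn => [odd_l|even_l].
  by rewrite even_ind_odd ?mulr0 //; lia.
have -> : halfz l%:Z = l./2%:Z by rewrite /halfz; lia.
rewrite -[in even_ind _](even_halfK even_l) even_ind_even mulr1.
case: l./2 a => [|h] [|a]; rewrite ?binz0 ?bin0 //.
  by rewrite (_ : _ + _ = h%:Z) ?binz_nat //; lia.
by rewrite (_ : _ + _ = (a + h.+1)%:Z) ?binz_nat //; lia.
Qed.

(** The series [x = z (1 - z + z^2) / (1 - z^2)^2] at which the Catalan series is
    evaluated. *)
Definition catalan_arg : {poly rat} := 'X * (1 - 'X * (1 - 'X)) * geom2 ^+ 2.

Lemma expr_1B (R : comNzRingType) (y : R) (n : nat) :
  (1 - y) ^+ n = \sum_(0 <= m < n.+1) 'C(n, m)%:R * (-1) ^+ m * y ^+ m.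
Proof.
rewrite exprBn big_mkord; apply: eq_bigr => m _.
by rewrite expr1n mulr1 -mulr_natl mulrA.
Qed.

(** The sums over [m] and [p] come from expanding [(1 - z (1 - z))^j], and then
    each [(1 - z)^m].  A degree [j + m + p] above [i] contributes nothing: the
    right-hand side then contains a binomial coefficient with a negative lower
    entry. *)
Lemma coef_catalan_argX (i j : nat) : (i < N)%N ->
  (catalan_arg ^+ j)`_i =
  \sum_(0 <= m < j.+1)
    binz j%:Z m%:Z * (-1) ^+ m
    * \sum_(0 <= p < m.+1)
        binz m%:Z p%:Z * (-1) ^+ p
        * binz (2 * j%:Z - 1 + halfz (i%:Z - j%:Z - m%:Z - p%:Z))
               (halfz (i%:Z - j%:Z - m%:Z - p%:Z))
        * even_ind (i%:Z - j%:Z - m%:Z - p%:Z).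
Proof.
move=> lt_iN.
have coefC (n e : nat) (q : {poly rat}) l :
    ('C(n, e)%:R * (-1) ^+ e * q)`_l = binz n%:Z e%:Z * (-1) ^+ e * q`_l.
  rewrite binz_nat -coefCM; congr (nth 0 (polyseq (_ * _)) l).
  by rewrite rmorphM rmorphXn rmorphN1 rmorph_nat.
rewrite /catalan_arg 2!exprMn -exprM expr_1B mulr_sumr mulr_suml coef_sum.
apply: eq_bigr => m _.
transitivity (('C(j, m)%:R * (-1) ^+ m *
    ('X^(j + m) * (1 - 'X) ^+ m * geom2 ^+ (2 * j)))`_i).
  by rewrite exprMn exprD mulrCA -!mulrA.
rewrite coefC; congr (_ * _).
rewrite expr_1B mulr_sumr mulr_suml coef_sum; apply: eq_bigr => p _.
transitivity (('C(m, p)%:R * (-1) ^+ p *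
    ('X^(j + m + p) * geom2 ^+ (2 * j)))`_i).
  by rewrite [in RHS]exprD mulrCA -!mulrA.
rewrite coefC -!mulrA; congr (_ * (_ * _)).
rewrite coefXnM; case: ltnP => [lt_i|le_i].
  by rewrite binz_halfz_neg ?mul0r //; lia.
rewrite coef_geom2X_binz; last by lia.
have -> : i%:Z - j%:Z - m%:Z - p%:Z = (i - (j + m + p))%N%:Z by lia.
by rewrite PoszM.
Qed.

Lemma coef_catalan_argX_small (i j : nat) :
  (i < j)%N -> (catalan_arg ^+ j)`_i = 0.
Proof. by move=> lt_ij; rewrite /catalan_arg -mulrA exprMn coefXnM lt_ij. Qed.

(** [C(x)^(k+1)], where [C] is the Catalan series. *)
Definition ballot_series (k : nat) : {poly rat} :=
  \sum_(j < N) ballot (k + j) k *: catalan_arg ^+ j.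

(** [z^k / (1 - z^2)^(k+1) C(x)^(k+1)], the generating function of the paths that
    end at height [k]. *)
Definition total_series (k : nat) : {poly rat} :=
  'X^k * geom2 ^+ k.+1 * ballot_series k.

Lemma coef_total_series (n k : nat) : (n < N)%N ->
  (total_series k)`_n =
  \sum_(0 <= i < n.+1 - k)
    binz (k%:Z + halfz (n%:Z - k%:Z - i%:Z)) (halfz (n%:Z - k%:Z - i%:Z))
    * even_ind (n%:Z - k%:Z - i%:Z)
    * \sum_(0 <= j < i.+1)
        ballot (k + j) k
        * \sum_(0 <= m < j.+1)
            binz j%:Z m%:Z * (-1) ^+ m
            * \sum_(0 <= p < m.+1)
                binz m%:Z p%:Z * (-1) ^+ p
                * binz (2 * j%:Z - 1 + halfz (i%:Z - j%:Z - m%:Z - p%:Z))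
                       (halfz (i%:Z - j%:Z - m%:Z - p%:Z))
                * even_ind (i%:Z - j%:Z - m%:Z - p%:Z).
Proof.
move=> lt_nN; rewrite /total_series -mulrA coefXnM; case: ltnP => [lt_nk|le_kn].
  by rewrite big_geq //; lia.
rewrite subSn // big_mkord coefMr; apply: eq_bigr => -[i /= lt_i] _.
rewrite coef_geom2X_binz; last by lia.
have -> : (n - k - i)%N%:Z = n%:Z - k%:Z - i%:Z by lia.
have -> : k.+1%:Z - 1 = k%:Z by lia.
congr (_ * _); rewrite coef_sum.
(* As [x^j] starts in degree [j], only the terms [j <= i] of the truncated
   ballot series contribute to the coefficient of degree [i]. *)
rewrite -(big_mkord xpredT (fun j => (ballot (k + j) k *: catalan_arg ^+ j)`_i)).
rewrite (@big_cat_nat _ _ _ i.+1) //=; last by lia.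
rewrite [X in _ + X]big_nat_cond [X in _ + X]big1 ?addr0.
  by apply: eq_bigr => j _; rewrite coefZ coef_catalan_argX //; lia.
move=> j /andP[/andP[lt_ij _] _].
by rewrite coefZ coef_catalan_argX_small ?mulr0.
Qed.

End Series.

(** * The recurrence of the ballot numbers *)

Lemma ballotE (k j : nat) :
  ballot (k + j) k = k.+1%:R / (k + j).+1%:R * 'C(k + 2 * j, j)%:R.
Proof.
rewrite /ballot; have -> : (k + j)%N%:Z - k%:Z = j%:Z by lia.
have -> : (2 * (k + j))%:Z - k%:Z = (k + 2 * j)%N%:Z by lia.
by rewrite binz_nat.
Qed.

Lemma ballot0 (k : nat) : ballot k k = 1.
Proof.
by have := ballotE k 0; rewrite !addn0 bin0 mulr1 divff ?pnatr_eq0.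
Qed.

(** The case [k = 0] of [C^(k+1) = C^k + x C^(k+2)], where [C^0 = 1]. *)
Lemma ballot0S (j : nat) : ballot j.+1 0 = ballot j.+1 1.
Proof.
have := ballotE 0 j.+1; have := ballotE 1 j; rewrite add0n add1n => -> ->.
have -> : (0 + 2 * j.+1 = (1 + 2 * j).+1)%N by lia.
rewrite binS -(bin_sub (m := j.+1)); last by lia.
have -> : (1 + 2 * j - j.+1 = j)%N by lia.
by rewrite addnn -mul2n natrM mulrA mul1r [_^-1 * _]mulrC.
Qed.

(** The rational function identity behind [ballotSS], with [a = k + j + 2] and
    [b = j + 1]; [c] and [d] are two consecutive binomial coefficients. *)
Lemma ballot_identity (a b c d : rat) :
    a != 0 -> a + 1 != 0 -> b * c = a * d ->
  (a - b + 1) / (a + 1) * (c + d) =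
  (a - b) / a * c + (a - b + 2%:R) / (a + 1) * d.
Proof.
move=> a0 a1 e; have ax := mulfV a0; have ay := mulfV a1.
have -> : d = a^-1 * (b * c) by rewrite e mulKf.
(* The identity becomes linear over the monomials once each side is multiplied
   by the missing denominator. *)
move: a^-1 (a + 1)^-1 ax ay => x y ax ay.
have := congr1 ( *%R ((a - b + 1) * y * c)) ax.
have := congr1 ( *%R ((a - b) * x * c)) ay.
lra.
Qed.

(** The coefficients of [C^(k+2) = C^(k+1) + x C^(k+3)]. *)
Lemma ballotSS (k j : nat) :
  ballot (k.+1 + j.+1) k.+1 = ballot (k + j.+1) k + ballot (k.+2 + j) k.+2.
Proof.
rewrite !ballotE.
have -> : (k.+1 + 2 * j.+1 = (k + 2 * j.+1).+1)%N by lia.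
have -> : (k.+2 + 2 * j = k + 2 * j.+1)%N by lia.
have := mul_bin_left (k + 2 * j.+1) j.
have -> : (k + 2 * j.+1 - j = k + j + 2)%N by lia.
rewrite binS; move: 'C(_, j) 'C(_, j.+1) => d c /(congr1 (fun x => x%:R : rat)).
rewrite !natrM => e.
have := @ballot_identity (k + j + 2)%:R j.+1%:R c%:R d%:R.
rewrite natr1 !pnatr_eq0 -natrB; last by lia.
have -> : (k + j + 2 - j.+1 = k.+1)%N by lia.
rewrite natr1 -!natrD !addnS !addSn !addn0 natrD => H.
apply: H => //; by rewrite e !addnS addn0.
Qed.

(** * The recurrence of the generating functions *)

Section Kernel.

Variable M : nat.
Local Notation N := M.+1.
Local Notation x := (catalan_arg N).
Local Notation B := (ballot_series N).
Local Notation T := (total_series N).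

Lemma ballot_series_recl (k : nat) :
  B k = 1 + \sum_(j < M) ballot (k + j.+1) k *: x ^+ j.+1.
Proof. by rewrite /ballot_series big_ord_recl addn0 ballot0 scale1r. Qed.

Lemma mul_catalan_arg_ballot_series (k : nat) :
  x * B k = \sum_(j < M) ballot (k + j) k *: x ^+ j.+1
              + ballot (k + M) k *: x ^+ N.
Proof.
rewrite /ballot_series mulr_sumr big_ord_recr /= -scalerAr -exprS.
by congr (_ + _); apply: eq_bigr => j _; rewrite -scalerAr -exprS.
Qed.

(** Truncation leaves the last term of [x C(x)^(k+3)] unmatched; it is a multiple
    of [x^N], hence of [z^N]. *)
Lemma ballot_seriesS (k : nat) :
  B k.+1 + ballot (k.+2 + M) k.+2 *: x ^+ N = B k + x * B k.+2.
Proof.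
rewrite mul_catalan_arg_ballot_series !ballot_series_recl.
rewrite [RHS]addrA -[in RHS](addrA 1) -big_split /=; congr (_ + _ + _); apply: eq_bigr => j _.
by rewrite ballotSS scalerDl.
Qed.

Lemma ballot_series0 :
  B 0 + ballot (1 + M) 1 *: x ^+ N = 1 + x * B 1.
Proof.
rewrite mul_catalan_arg_ballot_series ballot_series_recl addrA.
by congr (_ + _ + _); apply: eq_bigr => j _; rewrite add0n add1n ballot0S.
Qed.

(** Modulo [z^N], multiplication by [1 - z^2] cancels one factor [geom2], and
    [(1 - z + z^2) z] times two such factors is [x]: after division by
    [z^k / (1 - z^2)^k] the claim is the hypothesis.  Leaving [b] free covers at
    once [b = 1] at height 0 and [b = ballot_series k] above. *)
Lemma kernel_equation (k : nat) (b b' b'' : {poly rat}) (c : rat) :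
    b' + c *: x ^+ N = b + x * b'' ->
  exists r, (1 - 'X^2) * ('X^k * geom2 N ^+ k.+1 * b') =
    'X^k * geom2 N ^+ k * b
    + (1 - 'X * (1 - 'X)) * ('X^(k.+1) * geom2 N ^+ k.+2 * b'') + 'X^N * r.
Proof.
move=> e.
pose y := (1 - 'X * (1 - 'X)) * geom2 N ^+ 2.
pose P := 'X^k * geom2 N ^+ k.
exists (- (P * (c *: y ^+ N) + P * ('X^N * b'))).
have -> : (1 - 'X^2) * ('X^k * geom2 N ^+ k.+1 * b') =
          P * ((1 - 'X^2) * geom2 N * b').
  by rewrite [geom2 N ^+ _]exprS [LHS](AC (1*(1*2*1)) ((2*4)*((1*3)*5))).
have -> : (1 - 'X * (1 - 'X)) * ('X^(k.+1) * geom2 N ^+ k.+2 * b'') =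
          P * (x * b'').
  rewrite /catalan_arg ['X^_]exprS [geom2 N ^+ k.+2]exprS.
  rewrite [geom2 N ^+ k.+1]exprS expr2.
  by rewrite [LHS](AC (1*(2*(1*2)*1)) ((3*6)*((2*1*(4*5))*7))).
rewrite geom2_inv mulrBl mul1r -/P -mulrDr -e.
have -> : x ^+ N = 'X^N * y ^+ N by rewrite -exprMn mulrA.
rewrite mul2n -addnn exprD.
rewrite mulrN mulrBr !mulrDr !(mulrCA 'X^N P) -!scalerAr -!mulrA.
by rewrite opprD addrA addrK.
Qed.

Lemma total_series0_rec :
  exists r, T 0 - 'X^2 * T 0 = 1 + (T 1 - 'X * T 1 + 'X^2 * T 1) + 'X^N * r.
Proof.
have [r] := kernel_equation 0 ballot_series0; rewrite -!/(total_series N _) => e.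
exists r; rewrite -{1}[T 0]mul1r -mulrBl e expr0 !mul1r; congr (_ + _ + _).
by rewrite mulrBr mulr1 !mulrBl mul1r opprB -expr2 addrA addrAC.
Qed.

Lemma total_seriesS_rec (k : nat) :
  exists r, T k.+1 - 'X^2 * T k.+1 =
    'X * T k + (T k.+2 - 'X * T k.+2 + 'X^2 * T k.+2) + 'X^N * r.
Proof.
have [r] := kernel_equation k.+1 (ballot_seriesS k).
rewrite -!/(total_series N _) => e.
exists r; rewrite -{1}[T k.+1]mul1r -mulrBl e; congr (_ + _ + _).
  by rewrite /total_series ['X^_]exprS -!mulrA.
by rewrite mulrBr mulr1 !mulrBl mul1r opprB -expr2 addrA addrAC.
Qed.

(** The generating function of the paths to height [k] whose last step is not down:
    append a flat step at height [k] or an up step at height [k - 1]. *)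
Definition nodown_series (k : nat) : {poly rat} :=
  if k is h.+1 then 'X * (T h.+1 + T h) else 1 + 'X * T 0.

Local Notation A := nodown_series.

(** The recurrence in the shape in which removing the last step yields it; compare
    [size_all_paths_step]. *)
Lemma total_seriesB (n k : nat) : (n < N)%N ->
  (T k - T k.+1)`_n = (A k - A k.+1 + 'X * A k.+1)`_n.
Proof.
move=> lt_nN; have coef_tail r : ('X^N * r : {poly rat})`_n = 0.
  by rewrite coefXnM lt_nN.
case: k => [|k].
  have [r /(congr1 (coefp n))] := total_series0_rec.
  rewrite /= !(coefD, coefN, coef_tail, coefXnM, coefXM, coef1).
  by case: n {lt_nN coef_tail} => [|[|n]] /=; rewrite ?subSS ?subn0; lra.
have [r /(congr1 (coefp n))] := total_seriesS_rec k.
rewrite /= !(coefD, coefN, coef_tail, coefXnM, coefXM, coef1).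
by case: n {lt_nN coef_tail} => [|[|n]] /=; rewrite ?subSS ?subn0; lra.
Qed.

End Kernel.

(** * Removing the last step of a path *)

Lemma down_stepsP (s : vec) :
  down_steps s -> exists2 d, (0 < d)%N & s = down_step d.
Proof. by case=> d d_gt0 <-; exists d. Qed.

Lemma down_steps_snd (s : vec) : down_steps s -> s.2 < 0.
Proof. by case=> d /= d_gt0 <- /=; lia. Qed.

Lemma endpoint_rcons (p : seq vec) (s : vec) :
  endpoint (rcons p s) = endpoint p + s.
Proof.
by rewrite /endpoint /point !take_size -cats1 big_cat big_seq1.
Qed.

Lemma M1_rcons (p : seq vec) (s : vec) :
  M1 (rcons p s) <->
  [/\ M1 p, steps s, 0 <= height (endpoint p) + s.2
    & ~ (down_steps (last 0 p) /\ down_steps s)].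
Proof.
have point_rcons i : (i <= size p)%N -> point (rcons p s) i = point p i.
  by move=> le_ip; rewrite /point -cats1 takel_cat.
have point_last : point (rcons p s) (size p).+1 = endpoint p + s.
  by rewrite -endpoint_rcons /endpoint size_rcons.
have steps_fst v : steps v -> v.1 = 1 by case=> [[->|->]|[d _ <-]].
split=> [[hs hq hd]|[[hs hq hd] ss h0 nd]].
- split.
  + split=> [v vp|i le_ip|i lt_ip].
    * by apply: hs; rewrite mem_rcons inE vp orbT.
    * by rewrite -(point_rcons _ le_ip); apply: hq; rewrite size_rcons ltnW.
    * have := hd i; rewrite size_rcons ltnS ltnW // !nth_rcons lt_ip ltnW //.
      exact.
  + by apply: hs; rewrite mem_rcons inE eqxx.
  + have := hq (size p).+1; rewrite size_rcons point_last.
    by case/(_ (ltnSn _)).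
  (* The default value 0 is not a down step, so the empty path needs no special
     treatment. *)
  + case: (lastP p) hd => [|q v] hd; first by move=> [/down_steps_snd].
    have := hd (size q); rewrite !size_rcons ltnS leqnn last_rcons.
    by rewrite !nth_rcons size_rcons ltnn eqxx ltnS leqnn ltnn eqxx; apply.
- split=> [v|i|i].
  + by rewrite mem_rcons inE => /orP[/eqP ->|/hs].
  + rewrite size_rcons leq_eqVlt => /orP[/eqP ->|]; last first.
      by rewrite ltnS => le_ip; rewrite point_rcons //; apply: hq.
    rewrite point_last; split=> //.
    have [+ _] := hq _ (leqnn _); rewrite -/(endpoint p) /= (steps_fst _ ss).
    by move=> ?; rewrite addr_ge0.
  + rewrite size_rcons ltnS leq_eqVlt => /orP[/eqP e|lt_ip]; last first.
      by rewrite !nth_rcons lt_ip ltnW //; apply: hd.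
    rewrite -nth_last -e /= in nd.
    by rewrite !nth_rcons -e ltnn eqxx ltnS leqnn.
Qed.

Lemma M1_nil : M1 [::].
Proof. by split=> // i; rewrite /point /= big_nil. Qed.

(** Each step climbs by at most 1. *)
Lemma M1_height (p : seq vec) :
  M1 p -> exists2 h, (h <= size p)%N & height (endpoint p) = h%:Z.
Proof.
case=> hs hq _; have [_ ge0] := hq _ (leqnn _).
have := point_le hs (leqnn _); rewrite /height /endpoint.
by case: (point _ _).2 ge0 => // h _ le_hn; exists h.
Qed.

Lemma M1_paths_rcons (n k : nat) (p : seq vec) (s : vec) :
  M1_paths n.+1 k (rcons p s) <->
  exists h, [/\ M1_paths n h p, steps s, h%:Z + s.2 = k%:Z
    & ~ (down_steps (last 0 p) /\ down_steps s)].
Proof.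
rewrite /M1_paths /= size_rcons endpoint_rcons /height.
split=> [[/M1_rcons[Mp ss h0 nd] [sp] e]|[h [[Mp sp e] ss e' nd]]].
  by have [h _ eh] := M1_height Mp; exists h; split=> //; rewrite -eh.
split; [apply/M1_rcons; split=> // | by rewrite sp | by rewrite -e' -e].
by rewrite /height e e'.
Qed.

Lemma stepsP (s : vec) : steps s ->
  [\/ s = up_step, s = flat_step | exists2 d, (0 < d)%N & s = down_step d].
Proof.
by case=> [[|]|]; [constructor 1|constructor 2|move/down_stepsP; constructor 3].
Qed.

Lemma up_not_down : ~ down_steps up_step.
Proof. by move/down_steps_snd. Qed.

Lemma flat_not_down : ~ down_steps flat_step.
Proof. by move/down_steps_snd. Qed.

Lemma down_step_down (d : nat) : (0 < d)%N -> down_steps (down_step d).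
Proof. by exists d. Qed.

(** * Enumerating the paths *)

(** Whether the last step is down decides which steps may follow, whence the
    mutual recursion.  A down step to height [k] starts at some height [h > k];
    after [m] steps [h] is at most [m], so that the [m] heights following [k]
    suffice. *)
Fixpoint nodown_paths (n k : nat) : seq (seq vec) :=
  if n is m.+1 then
    [seq rcons p flat_step | p <- nodown_paths m k ++ down_paths m k] ++
    (if k is h.+1 then
       [seq rcons p up_step | p <- nodown_paths m h ++ down_paths m h]
     else [::])
  else if k is 0 then [:: [::]] else [::]
with down_paths (n k : nat) : seq (seq vec) :=
  if n is m.+1 then
    [seq rcons p (down_step (h - k)) | h <- iota k.+1 m, p <- nodown_paths m h]
  else [::].

Definition all_paths n k := nodown_paths n k ++ down_paths n k.

Lemma mem_cat_split (T : eqType) (l1 l2 : seq T) (x : T) (P Q : Prop) :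
  (x \in l1 <-> P /\ ~ Q) -> (x \in l2 <-> P /\ Q) ->
  (x \in l1 ++ l2 <-> P).
Proof.
move=> [i1 j1] [i2 j2]; rewrite mem_cat; split=> [/orP[/i1|/i2] []//|p].
by apply/orP; have [q|q] := pselect Q; [right; apply: j2|left; apply: j1].
Qed.

(** Both statements are proved together because a down step can only follow a path
    of the first kind, and a flat or an up step any path. *)
Lemma mem_nodown_down (n k : nat) (p : seq vec) :
  (p \in nodown_paths n k <-> M1_paths n k p /\ ~ down_steps (last 0 p)) /\
  (p \in down_paths n k <-> M1_paths n k p /\ down_steps (last 0 p)).
Proof.
elim: n k p => [|n IHn] k p.
  split=> /=; last first.
    split=> // -[[_ /size0nil -> _]]; by move/down_steps_snd.
  split=> [|[[_ /size0nil -> ]]]; last first.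
    by rewrite /endpoint /point big_nil; case: k.
  case: k => // /[!inE] /eqP ->; split; last by move/down_steps_snd.
  by split; rewrite ?/endpoint ?/point ?big_nil //; exact: M1_nil.
have mem_all h q : q \in nodown_paths n h ++ down_paths n h <-> M1_paths n h q.
  by have [lP fP] := IHn h q; exact: mem_cat_split lP fP.
case: (lastP p) => [|q s].
  split; split=> [|[[_ //]]] /=.
    rewrite mem_cat => /orP[/mapP[q _]|]; first by case: q.
    by case: k => // k /mapP[q _]; case: q.
  by case/allpairsPdep=> h [q [_ _]]; case: q.
have rcons_eq (q' q0 : seq vec) s' s0 : rcons q' s' = rcons q0 s0 ->
    q' = q0 /\ s' = s0 by move/rcons_inj=> [].
rewrite last_rcons; split; split.
- rewrite /= mem_cat => /orP[/mapP[q' q'in /rcons_eq[-> ->]]|].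
    split; last exact: flat_not_down.
    apply/M1_paths_rcons; exists k; split; [exact/mem_all| |by rewrite addr0|].
      by left; right.
    by move=> [_ /flat_not_down].
  case: k => // k /mapP[q' q'in /rcons_eq[-> ->]].
  split; last exact: up_not_down.
  apply/M1_paths_rcons; exists k; split; [exact/mem_all|by left; left| |].
    by rewrite /=; lia.
  by move=> [_ /up_not_down].
- move=> [/M1_paths_rcons[h [Mq /stepsP ss e nd]] nds] /=; rewrite mem_cat.
  case: ss e nds => [-> e _|-> e _|[d d_gt0 ->] _ []]; last exact: down_step_down.
    apply/orP; right; have -> : k = h.+1 by move: e; rewrite /=; lia.
    by apply: map_f; apply/mem_all.
  apply/orP; left; have -> : k = h by move: e; rewrite /=; lia.
  by apply: map_f; apply/mem_all.
- case/allpairsPdep=> h [q' [hin q'in /rcons_eq[-> ->]]].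
  have d_gt0 : (0 < h - k)%N by move: hin; rewrite mem_iota; lia.
  split; last exact: down_step_down.
  have [/(_ q'in)[Mq' nd] _] := (IHn h q').1.
  apply/M1_paths_rcons; exists h; split=> //; [|by rewrite /=; lia|by case].
  by right; exact: down_step_down.
- move=> [/M1_paths_rcons[h [Mq _ e nd]] ds].
  have [d d_gt0 ed] := down_stepsP ds.
  apply/allpairsPdep; exists h, q; split.
  + have [Mq1 sq eq] := Mq; have [h' le_h' eh'] := M1_height Mq1.
    move: e; rewrite ed mem_iota /=; move: eh' le_h'; rewrite eq sq; lia.
  + by apply/(IHn h q).1; split=> // dq; apply: nd.
  + by rewrite ed; congr (rcons _ (down_step _)); move: e; rewrite ed /=; lia.
Qed.

Lemma mem_all_paths (n k : nat) (p : seq vec) :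
  p \in all_paths n k <-> M1_paths n k p.
Proof.
by have [lP fP] := mem_nodown_down n k p; exact: mem_cat_split lP fP.
Qed.

Lemma uniq_nodown_cat_down (n k : nat) :
  uniq (nodown_paths n k) -> uniq (down_paths n k) -> uniq (all_paths n k).
Proof.
move=> ul uf; rewrite cat_uniq ul uf andbT; apply/hasPn => p pf; apply/negP => pl.
have [[/(_ pl)[_ nd] _] [/(_ pf)[_ d] _]] := mem_nodown_down n k p.
exact: nd d.
Qed.

Lemma uniq_all_paths (n k : nat) : uniq (all_paths n k).
Proof.
suff [ul uf] : uniq (nodown_paths n k) /\ uniq (down_paths n k).
  exact: uniq_nodown_cat_down.
elim: n k => [|n IHn] k; first by case: k.
have uall h : uniq (nodown_paths n h ++ down_paths n h).
  by have [ul uf] := IHn h; exact: uniq_nodown_cat_down.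
split=> /=.
  rewrite cat_uniq map_inj_uniq ?uall //; last exact: rcons_injl.
  case: k => // k; rewrite map_inj_uniq ?uall ?andbT; last exact: rcons_injl.
  by apply/hasPn => p /mapP[q _ ->]; apply/negP => /mapP[q' _ /rcons_inj[]].
apply: allpairs_uniq_dep; first exact: iota_uniq.
  by move=> h _; have [] := IHn h.
move=> /= u v /allpairsPdep[h [p [hin pin ->]]].
move=> /allpairsPdep[h' [p' [hin' pin' ->]]] /= /rcons_inj[e1 e2].
move: hin hin'; rewrite !mem_iota => hin hin'.
have eh : h = h' by lia.
by rewrite e1 eh.
Qed.

Lemma t_size (n k : nat) : t n k = size (all_paths n k).
Proof.
apply/perm_size/uniq_perm; [exact: fset_uniq|exact: uniq_all_paths|].
move=> p; apply/idP/idP.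
  rewrite in_fset_set; last exact: finite_M1_paths.
  by rewrite inE => /mem_all_paths.
move=> /mem_all_paths Mp; rewrite in_fset_set; last exact: finite_M1_paths.
by rewrite inE.
Qed.

Lemma all_paths_high (n k : nat) : (n < k)%N -> all_paths n k = [::].
Proof.
move=> lt_nk; case e : all_paths => [//|p l].
have /mem_all_paths[Mp sp ep] : p \in all_paths n k by rewrite e mem_head.
by have [h] := M1_height Mp; rewrite sp ep; lia.
Qed.

(** The down steps to height [k] start at the heights above [k]: those from above
    [k + 1] are as many as the down steps to height [k + 1], and the remaining
    ones start at height [k + 1] exactly.  Subtraction-free form of
    [T_k - T_(k+1) = A_k - A_(k+1) + z A_(k+1)]. *)
Lemma size_all_paths_step (n k : nat) :
  (size (all_paths n.+1 k) + size (nodown_paths n.+1 k.+1) =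
   size (all_paths n.+1 k.+1) + size (nodown_paths n.+1 k)
   + size (nodown_paths n k.+1))%N.
Proof.
have sf h : size (down_paths n.+1 h) =
    sumn [seq size (nodown_paths n i) | i <- iota h.+1 n].
  by rewrite /= size_allpairs_dep.
suff e : size (down_paths n.+1 k) =
    (size (down_paths n.+1 k.+1) + size (nodown_paths n k.+1))%N.
  by rewrite /all_paths !size_cat e; lia.
rewrite !sf.
(* The heights [k + 1, ..., k + n] can be extended to [k + n + 1], which is out of
   reach after [n] steps. *)
have last0 : size (nodown_paths n (k.+1 + n)) = 0.
  have := @all_paths_high n (k.+1 + n) ltac:(lia).
  by move=> /(congr1 size); rewrite size_cat /=; lia.
have : sumn [seq size (nodown_paths n i) | i <- iota k.+1 n.+1] =
       sumn [seq size (nodown_paths n i) | i <- iota k.+1 n].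
  by rewrite -[n.+1]addn1 iotaD map_cat sumn_cat /= last0 !addn0.
by rewrite /= => <-; rewrite addnC.
Qed.

(** * Comparing the two sides *)

(** Induction on the length: the number of paths without final down step depends
    on shorter paths only, and for all paths both sides have the same difference
    between heights [k] and [k + 1] and vanish at large heights. *)
Lemma size_paths_series (M n k : nat) : (n < M.+1)%N ->
  (size (nodown_paths n k))%:R = (nodown_series M k)`_n /\
  (size (all_paths n k))%:R = (total_series M.+1 k)`_n.
Proof.
have total_low m h : (m < h)%N -> (total_series M.+1 h)`_m = 0.
  by move=> lt_mh; rewrite /total_series -mulrA coefXnM lt_mh.
have nodown0 h : (size (nodown_paths 0 h))%:R = (nodown_series M h)`_0.
  by case: h => [|h]; rewrite /nodown_series ?coefD coefXM ?coef1 ?addr0.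
have nodown_of m h :
    (forall i, (size (all_paths m i))%:R = (total_series M.+1 i)`_m) ->
  (size (nodown_paths m.+1 h))%:R = (nodown_series M h)`_m.+1.
  move=> all_m; have e_size : size (nodown_paths m.+1 h) =
    (size (all_paths m h) + if h is i.+1 then size (all_paths m i) else 0)%N.
    by rewrite /= size_cat size_map; case: h => [|h]; rewrite ?size_map.
  rewrite e_size natrD all_m; case: h {e_size} => [|h].
    by rewrite addr0 /nodown_series coefD coefXM coef1 add0r.
  by rewrite all_m /nodown_series coefXM coefD.
have total_of m : (forall h, (size (all_paths m h))%:R
      - (size (all_paths m h.+1))%:R = (total_series M.+1 h)`_m
      - (total_series M.+1 h.+1)`_m) ->
    forall h, (size (all_paths m h))%:R = (total_series M.+1 h)`_m.
  move=> step h; have [d] := ubnP (m.+1 - h); elim: d h => // d IHd h lt_d.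
  have [lt_mh|le_hm] := ltnP m h; first by rewrite all_paths_high ?total_low.
  by have := step h; rewrite (IHd h.+1) => [/addIr|]; last by lia.
elim: n k => [|n IHn] k lt_n.
  split; first exact: nodown0.
  apply: total_of => h; rewrite -coefB total_seriesB // coefD coefXM addr0.
  by rewrite coefB -!nodown0 /all_paths !cats0 subr0 addr0.
have IHa i := (IHn i (ltnW lt_n)).2; have IHl i := (IHn i (ltnW lt_n)).1.
split; first exact: nodown_of.
apply: total_of => h; rewrite -coefB total_seriesB // coefD coefB.
rewrite -!nodown_of // [('X * _)`_ _]coefXM -IHl.
have := congr1 (fun x => x%:R : rat) (size_all_paths_step n h).
rewrite !natrD; lra.
Qed.

Theorem proposition2 (n k : nat) :
  (t n k)%:R =
  \sum_(0 <= i < n.+1 - k)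
    binz (k%:Z + halfz (n%:Z - k%:Z - i%:Z)) (halfz (n%:Z - k%:Z - i%:Z))
    * even_ind (n%:Z - k%:Z - i%:Z)
    * \sum_(0 <= j < i.+1)
        ballot (k + j) k
        * \sum_(0 <= m < j.+1)
            binz j%:Z m%:Z * (-1) ^+ m
            * \sum_(0 <= p < m.+1)
                binz m%:Z p%:Z * (-1) ^+ p
                * binz (2 * j%:Z - 1 + halfz (i%:Z - j%:Z - m%:Z - p%:Z))
                       (halfz (i%:Z - j%:Z - m%:Z - p%:Z))
                * even_ind (i%:Z - j%:Z - m%:Z - p%:Z) :> rat.
Proof.
rewrite t_size (size_paths_series k (ltnSn n)).2.
exact: coef_total_series.
Qed.
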